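(* Let $H$ be a real Hilbert space and let $C$ be a nonempty closed and convex subset of $H$. Let $\{f_i\}_{i=1}^{\infty}$ be a countable family of bifunctions from $C\times C$ into $\mathbb{R}$, each satisfying conditions (A1)-(A4) listed in the context; let $\{A_j\}_{j=1}^{\infty}$ be a countable family of continuous monotone mappings from $C$ into $H$; let $\{T_n\}_{n=1}^{\infty}$ be a countable family of nonexpansive-type mappings from $C$ into $H$, and let $\Gamma$ be a family of closed nonexpansive-type mappings from $C$ into $H$ with $\bigcap_{n=1}^{\infty}F(T_n)=F(\Gamma)\ne\emptyset$, such that $\{T_n\}$ satisfies the NST-condition with $\Gamma$. Suppose that $$B=F(\Gamma)\cap\Big[\bigcap_{i=1}^{\infty}EP(f_i)\Big]\cap\Big[\bigcap_{j=1}^{\infty}VI(C,A_j)\Big]$$ is nonempty, closed and convex. Let $\mu,\nu:\mathbb{N}\to\mathbb{N}$ be maps such that $\{n:\mu(n)=i\}$ and $\{n:\nu(n)=j\}$ are infinite for all $i,j\in\mathbb{N}$. Let $h:C\to C$ be a contraction with coefficient $\rho\in(0,1)$ and let $\bar u\in C$. Let $\{\lambda_n\},\{\sigma_n\}\subset[0,1)$ satisfy $\lambda_n+\sigma_n<1$ for all $n$, $\lambda_n\to0$ and $\sigma_n\to0$. Let $\alpha_1,\alpha_2,\alpha_3\in(0,1)$ with $\alpha_1+\alpha_2+\alpha_3=1$, and let $\{r_n\}\subset[a,\infty)$ for some $a>0$. Starting from $x_1\in C$ and $C_1=C$, define for all $n\ge1$ $$\begin{aligned} s_n&=\lambda_nh(x_n)+\sigma_n\bar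 u+(1-\lambda_n-\sigma_n)x_n,\\ z_n&=\Big\{z\in C: f_{\mu(n)}(z,y)+\tfrac1{r_n}\langle y-z,z-s_n\rangle\ge0\ \ \forall y\in C\Big\},\\ u_n&=\Big\{z\in C:\langle y-z,A_{\nu(n)}z\rangle+\tfrac1{r_n}\langle y-z,z-s_n\rangle\ge0\ \ \forall y\in C\Big\},\\ y_n&=\alpha_1s_n+\alpha_2z_n+\alpha_3T_nu_n,\\ C_{n+1}&=\{v\in C_n:\|v-y_n\|\le\|v-s_n\|\},\\ x_{n+1}&=P_{C_{n+1}}x_1 . \end{aligned}$$ Then $\{x_n\}$ converges strongly to $P_Bx_1$, where $P_K$ denotes the metric projection of $H$ onto a nonempty closed convex set $K$.
   Context: $\langle\cdot,\cdot\rangle$ is the inner product of $H$. For $T:C\to H$, $F(T)=\{p\in C:Tp=p\}$, and $F(\Gamma)=\bigcap_{T\in\Gamma}F(T)$. ''Nonexpansive-type'' means: $F(T)\ne\emptyset$ and $\|p-Tx\|\le\|p-x\|$ for all $x\in C$, $p\in F(T)$. $T$ is closed if whenever $x_n\in C$, $x_n\to x$ and $Tx_n\to y$, then $Tx=y$. NST-condition: $\{T_n\}$ satisfies the NST-condition with $\Gamma$ if for each bounded sequence $\{x_n\}\subset C$, $\|x_n-T_nx_n\|\to0$ implies $\|x_n-Tx_n\|\to0$ for all $T\in\Gamma$. Conditions on a bifunction $f:C\times C\to\mathbb{R}$: (A1) $f(x,x)=0$ for all $x\in C$; (A2) $f(x,y)+f(y,x)\le0$ for all $x,y\in C$; (A3)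 $\limsup_{t\downarrow0}f(tz+(1-t)x,y)\le f(x,y)$ for all $x,y,z\in C$; (A4) for each $x\in C$, $f(x,\cdot)$ is convex and lower semicontinuous. Solution sets: $EP(f)=\{x\in C:f(x,y)\ge0\ \forall y\in C\}$; $VI(C,A)=\{x\in C:\langle y-x,Ax\rangle\ge0\ \forall y\in C\}$. $A:C\to H$ is monotone if $\langle x-y,Ax-Ay\rangle\ge0$ for all $x,y\in C$. Convention: ''$z_n=\{z\in C:\dots\}$'' and ''$u_n=\{z\in C:\dots\}$'' mean that the set on the right is a singleton whose unique element is $z_n$, respectively $u_n$. *)

(* Defs.v *)
From HB Require Import structures.
From mathcomp Require Import all_boot all_order all_algebra.
From mathcomp Require Import all_classical all_reals all_analysis.

Set Implicit Arguments.
Unset Strict Implicit.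
Unset Printing Implicit Defensive.

Import Order.TTheory GRing.Theory Num.Theory.
Import numFieldNormedType.Exports.

Local Open Scope classical_set_scope.
Local Open Scope ring_scope.

(* A real Hilbert space is a complete normed module H over R with a positive
   definite symmetric bilinear form that induces its norm. *)
Definition induces_norm (R : realType) (H : completeNormedModType R)
    (dot : {dot H for (@idfun R)}) : Prop :=
  forall x : H, `|x| ^+ 2 = dot x x.

(* Maps C -> H are represented by total functions H -> H (and bifunctions on C
   by functions H -> H -> R); values outside C are never constrained. *)

Section Mappings.
Context (R : realType) (H : completeNormedModType R) (C : set H).

Definition fixpts (T : H -> H) : set H := [set p | C p /\ T p = p].

Definition common_fixpts (Gamma : set (H -> H)) : set H :=
  \bigcap_(T in Gamma) fixpts T.

Definition nonexpansive_type (T : H -> H) : Prop :=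
  fixpts T !=set0 /\
  forall x p, C x -> fixpts T p -> `|p - T x| <= `|p - x|.

Definition closed_mapping (T : H -> H) : Prop :=
  forall (u : nat -> H) (x y : H), (forall n, C (u n)) ->
    u n @[n --> \oo] --> x -> T (u n) @[n --> \oo] --> y -> T x = y.

Definition NST_condition (T : nat -> H -> H) (Gamma : set (H -> H)) : Prop :=
  forall u : nat -> H, (forall n, C (u n)) -> bounded_fun u ->
    `|u n - T n (u n)| @[n --> \oo] --> (0 : R) ->
    forall S, Gamma S -> `|u n - S (u n)| @[n --> \oo] --> (0 : R).

(* Lower semicontinuity of f x is relative to C, hence the subspace topology. *)
Record equilibrium_bifunction (f : H -> H -> R) : Prop := {
  eqb_diag : forall x, C x -> f x x = 0 ;
  eqb_monotone : forall x y, C x -> C y -> f x y + f y x <= 0 ;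
  eqb_hemicontinuous : forall x y z, C x -> C y -> C z ->
    (limf_esup (fun t : R => (f (t *: z + (1 - t) *: x) y)%:E) (0 : R)^'+
       <= (f x y)%:E)%E ;
  eqb_convex : forall x, C x -> convex_function C (f x) ;
  eqb_lsc : forall x, C x ->
    @lower_semicontinuous (subspace C) R (fun y => (f x y)%:E) }.

Definition EP (f : H -> H -> R) : set H :=
  [set x | C x /\ forall y, C y -> 0 <= f x y].

Definition monotone_mapping (dot : {dot H for (@idfun R)}) (A : H -> H) : Prop :=
  forall x y, C x -> C y -> 0 <= dot (x - y) (A x - A y).

Definition VI (dot : {dot H for (@idfun R)}) (A : H -> H) : set H :=
  [set x | C x /\ forall y, C y -> 0 <= dot (y - x) (A x)].

End Mappings.

(* The default value x is irrelevant: when K is a nonempty closed convex subset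
   of a Hilbert space, exactly one point of K minimizes the distance to x. *)
Definition metric_proj (R : realType) (H : completeNormedModType R)
    (K : set H) (x : H) : H :=
  xget x [set p | K p /\ forall q, K q -> `|x - p| <= `|x - q|].

(* Main.v *)
Require Import Defs.
From HB Require Import structures.
From mathcomp Require Import all_boot all_order all_algebra.
From mathcomp Require Import all_classical all_reals all_analysis.
From mathcomp Require Import ring lra.
Import Order.TTheory GRing.Theory Num.Theory.
Import numFieldNormedType.Exports.
Local Open Scope classical_set_scope.
Local Open Scope ring_scope.

(** For every common solution p, the resolvent points satisfy
    |p - z_n|^2 + |z_n - s_n|^2 <= |p - s_n|^2 (monotonicity of f), and likewise
    for u_n, so convexity of the squared norm gives
      alpha2 |z_n - s_n|^2 + alpha3 |u_n - s_n|^2 <= |p - s_n|^2 - |p - y_n|^2.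
    Hence B is contained in every C_n, so |x_1 - x_n| is nondecreasing and bounded,
    and the parallelogram identity makes the successive projections x_n a Cauchy
    sequence.  Since x_(n+1) lies in C_(n+1), the points s_n, y_n, and then, by the
    displayed inequality, z_n, u_n and T_n u_n share the limit of x_n.  This limit is
    fixed by Gamma (NST condition), and it solves the i-th equilibrium problem and the
    j-th variational inequality by passing to the limit along the infinite sets
    {mu = i} and {nu = j}.  Being in B and at distance from x_1 no larger than any
    point of B, it is the projection. *)

Set Implicit Arguments.
Unset Strict Implicit.
Unset Printing Implicit Defensive.

Section Hilbert.
Context (R : realType).

(** * Convex combinations with real weights *)

(** [convex_set] and [convex_function] take weights in [{i01 R}]; this lets plain real weights be
    fed to them. *)
Lemma i01_num (t : R) : 0 <= t <= 1 -> exists k : {i01 R}, k%:num = t.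
Proof.
move=> /andP[t0 t1].
have t01 : Itv.spec (Itv.num_sem (R:=R)) (Itv.Real `[0%Z, 1%Z]) t.
  by rewrite /= /Itv.num_sem num_real /= in_itv /= t0 t1.
by exists (Itv.mk t01).
Qed.

Lemma convex_setP (H : lmodType R) (K : set H) : convex_set K <->
  forall (t : R) p q, 0 <= t <= 1 -> K p -> K q -> K (t *: p + (1 - t) *: q).
Proof.
split=> [cK t p q /i01_num[k <-] Kp Kq|cK p q t].
  by have := cK p q k; rewrite !inE; exact.
by rewrite !inE => Kp Kq; apply: cK => //; rewrite ge0 le1.
Qed.

Lemma convex_function_le (H : lmodType R) (K : set H) (g : H -> R) (t : R) p q :
  convex_function K g -> 0 <= t <= 1 -> K p -> K q ->
  g (t *: p + (1 - t) *: q) <= t * g p + (1 - t) * g q.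
Proof. by move=> cg /i01_num[k <-] Kp Kq; apply: cg; rewrite inE. Qed.

Lemma sub_affine2 (H : lmodType R) (t : R) (x p q : H) :
  x - (t *: p + (1 - t) *: q) = t *: (x - p) + (1 - t) *: (x - q).
Proof. by rewrite !scalerBr addrACA -scalerDl [t + _]addrC subrK scale1r -opprD. Qed.

Context (H : completeNormedModType R).
Context (dot : {dot H for (@idfun R)}) (hdot : induces_norm dot).

(** * Inner product identities and limits *)

Lemma dotC u v : dot u v = dot v u.
Proof. by rewrite hermC expr0 mul1r. Qed.

Lemma dotDl u v w : dot (u + v) w = dot u w + dot v w.
Proof. exact: linearDl. Qed.

Lemma dotZl k u w : dot (k *: u) w = k * dot u w.
Proof. exact: linearZl_LR. Qed.

Lemma dotZr k u w : dot w (k *: u) = k * dot w u.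
Proof. by rewrite dotC dotZl dotC. Qed.

Lemma sqr_normD u v : `|u + v| ^+ 2 = `|u| ^+ 2 + 2 * dot u v + `|v| ^+ 2.
Proof. by rewrite !hdot linearDl !linearDr /= (dotC v u); ring. Qed.

Lemma sqr_normB u v : `|u - v| ^+ 2 = `|u| ^+ 2 - 2 * dot u v + `|v| ^+ 2.
Proof. by rewrite sqr_normD normrN linearNr /=; ring. Qed.

Lemma sqr_normZ k (u : H) : `|k *: u| ^+ 2 = k ^+ 2 * `|u| ^+ 2.
Proof. by rewrite normrZ exprMn real_normK ?num_real. Qed.

(** Once [a] is eliminated, both sides are the same polynomial in the weights, norms and inner
    products. Used with the weights of [y n]. *)
Lemma sqr_norm_affine3 (a b c : R) (u v w : H) : a + b + c = 1 ->
  `|a *: u + b *: v + c *: w| ^+ 2 =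
    a * `|u| ^+ 2 + b * `|v| ^+ 2 + c * `|w| ^+ 2
    - a * b * `|u - v| ^+ 2 - a * c * `|u - w| ^+ 2 - b * c * `|v - w| ^+ 2.
Proof.
move=> abc; have -> : a = 1 - b - c by lra.
rewrite !sqr_normB !sqr_normD !sqr_normZ dotDl !dotZl !dotZr.
by ring.
Qed.

Lemma sqr_norm_affine2 (t : R) (u v : H) :
  `|t *: u + (1 - t) *: v| ^+ 2 =
    t * `|u| ^+ 2 + (1 - t) * `|v| ^+ 2 - t * (1 - t) * `|u - v| ^+ 2.
Proof.
have := @sqr_norm_affine3 t (1 - t) 0 u v 0.
by rewrite scale0r !addr0 !mulr0 !mul0r !subr0 addr0; apply; ring.
Qed.

(** Polarization reduces this to continuity of the norm. *)
Lemma cvg_dot {T : Type} (F : set_system T) (FF : Filter F) (g k : T -> H) u v :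
  g @ F --> u -> k @ F --> v -> dot (g t) (k t) @[t --> F] --> dot u v.
Proof.
have polar x y : dot x y = 2^-1 * (`|x + y| ^+ 2 - `|x| ^+ 2 - `|y| ^+ 2).
  by rewrite sqr_normD; field.
move=> gu kv; under eq_fun do rewrite polar.
rewrite polar; apply: cvgMl_tmp; apply: cvgB; first apply: cvgB.
- rewrite expr2; under eq_fun do rewrite expr2.
  by apply: cvgM; apply: cvg_norm; apply: cvgD.
- by rewrite expr2; under eq_fun do rewrite expr2; apply: cvgM; apply: cvg_norm.
- by rewrite expr2; under eq_fun do rewrite expr2; apply: cvgM; apply: cvg_norm.
Qed.

(** Completeness in a quantitative form, applied both to minimizing sequences and to the
    iterates. *)
Lemma cvg_of_sqr_dist (q : nat -> H) (e : nat -> R) :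
  e n @[n --> \oo] --> 0 ->
  (forall m n, (n <= m)%N -> `|q n - q m| ^+ 2 <= e n) -> cvgn q.
Proof.
move=> e0 qe; apply/cauchy_cvgP/cauchy_exP => eps eps0.
have [N _ /(_ N (leqnn N)) eN] : \forall n \near \oo, `|0 - e n| < eps ^+ 2.
  by apply: cvgr_dist_lt => //; rewrite exprn_gt0.
exists (q N); exists N => // m Nm; rewrite -ball_normE /ball_ /=.
rewrite -(@ltr_pXn2r _ 2) ?nnegrE ?(ltW eps0)//.
by rewrite (le_lt_trans (qe _ _ Nm))// (le_lt_trans _ eN)// sub0r normrN ler_norm.
Qed.

(** * Metric projection onto a closed convex set *)

Section Projection.
Context (K : set H) (K_neq0 : K !=set0) (K_closed : closed K).
Context (K_convex : convex_set K) (x : H).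

(** Parallelogram law: the midpoint of [p] and [q] lies in [K], so its distance to [x] is at least
    [d]. *)
Lemma sqr_dist_near_proj (d : R) p q : 0 <= d -> (forall v, K v -> d <= `|x - v|) ->
  K p -> K q ->
  `|p - q| ^+ 2 <= 2 * `|x - p| ^+ 2 + 2 * `|x - q| ^+ 2 - 4 * d ^+ 2.
Proof.
move=> d0 dK Kp Kq.
have t01 : 0 <= (2^-1 : R) <= 1 by lra.
have := dK _ ((convex_setP _).1 K_convex _ _ _ t01 Kp Kq).
rewrite -(@ler_pXn2r _ 2) ?nnegrE// sub_affine2 sqr_norm_affine2.
have -> : x - p - (x - q) = q - p by rewrite opprB addrC addrA subrK.
by rewrite (distrC q p); lra.
Qed.

Lemma sqr_dist_proj p q : K p -> (forall v, K v -> `|x - p| <= `|x - v|) -> K q ->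
  `|p - q| ^+ 2 <= 2 * (`|x - q| ^+ 2 - `|x - p| ^+ 2).
Proof.
by move=> Kp pmin Kq; have := sqr_dist_near_proj (normr_ge0 _) pmin Kp Kq; lra.
Qed.

(** A minimizing sequence is Cauchy by the previous estimate, and its limit stays in the closed set
    [K]. *)
Lemma proj_exists : exists p, K p /\ forall q, K q -> `|x - p| <= `|x - q|.
Proof.
have [d [d0 dK dadh]] : exists d : R, [/\ 0 <= d,
    (forall v, K v -> d <= `|x - v|) &
    forall e : R, 0 < e -> exists q, K q /\ `|x - q| < d + e].
  pose D := [set `|x - q| | q in K].
  have D0 : D !=set0 by case: K_neq0 => q Kq; exists `|x - q|; exists q.
  have Dinf : has_inf D by split => //; exists 0 => _ [q _ <-].
  exists (inf D); split.
  - by apply: lb_le_inf => // _ [q _ <-].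
  - by move=> v Kv; apply: (ge_inf Dinf.2); exists v.
  - by move=> e /inf_adherent/(_ Dinf)[_ [q Kq <-] qd]; exists q.
have /choice[q qP] (n : nat) : exists q, K q /\ `|x - q| < d + n.+1%:R^-1.
  by apply: dadh; rewrite invr_gt0.
have qK n : K (q n) by case: (qP n).
have inv0 : (n.+1%:R^-1 : R) @[n --> \oo] --> 0 by exact: cvg_harmonic.
have dinv : d + (n.+1%:R^-1 : R) @[n --> \oo] --> d.
  by rewrite -[X in _ --> X]addr0; apply: cvgD => //; apply: cvg_cst.
have xq n m : (n <= m)%N -> `|x - q m| ^+ 2 <= (d + n.+1%:R^-1) ^+ 2.
  move=> nm; rewrite ler_pXn2r ?nnegrE ?addr_ge0//.
  apply: (le_trans (ltW (qP m).2)); rewrite lerD2l lef_pV2 ?posrE ?ltr0n//.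
  by rewrite ler_nat.
(* This is the bound of [sqr_dist_near_proj] when both distances are at most [d + n.+1%:R^-1]. *)
have e0 : 4 * ((d + n.+1%:R^-1) ^+ 2 - d ^+ 2) @[n --> \oo] --> 0.
  rewrite -[X in _ --> X](mulr0 4) -(subrr (d ^+ 2)).
  apply: cvgMl_tmp; apply: cvgB; last exact: cvg_cst.
  by rewrite expr2; under eq_fun do rewrite expr2; exact: cvgM.
have /cvg_ex[l ql] : cvgn q.
  apply: (cvg_of_sqr_dist e0) => m n nm.
  have := sqr_dist_near_proj d0 dK (qK n) (qK m).
  have := xq _ _ (leqnn n); have := xq _ _ nm.
  by move: (d + _) => en; lra.
exists l; split.
  by apply: (closed_cvg _ K_closed _ _ ql); exact: nearW.
move=> v /dK; apply: le_trans; apply: ler_cvg_to dinv _.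
  by apply: cvg_norm; apply: cvgB; [exact: cvg_cst|exact: ql].
by apply: nearW => n; exact: ltW (qP n).2.
Qed.

Lemma metric_projP : K (metric_proj K x) /\
  forall q, K q -> `|x - metric_proj K x| <= `|x - q|.
Proof. exact: xgetPex proj_exists. Qed.

Lemma metric_proj_unique p : K p -> (forall q, K q -> `|x - p| <= `|x - q|) ->
  metric_proj K x = p.
Proof.
have [Pk Pmin] := metric_projP => Kp pmin.
have := sqr_dist_proj Pk Pmin Kp.
have : `|x - p| ^+ 2 <= `|x - metric_proj K x| ^+ 2.
  by rewrite ler_pXn2r ?nnegrE// pmin.
move=> h1 h2; have : `|metric_proj K x - p| ^+ 2 <= 0 by lra.
by rewrite exprn_even_le0//= normr_eq0 subr_eq0 => /eqP.
Qed.

End Projection.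

(** After squaring, the quadratic correction [t * (1 - t) * |q - p|^2] is the same on both sides and
    cancels. *)
Lemma convex_closer (y s : H) : convex_set [set v : H | `|v - y| <= `|v - s|].
Proof.
have sqrE (v : H) : (`|v - y| <= `|v - s|) = (`|y - v| ^+ 2 <= `|s - v| ^+ 2).
  by rewrite ler_pXn2r ?nnegrE// (distrC v y) (distrC v s).
apply/convex_setP => t p q /andP[t0 t1] /=; rewrite !sqrE => py qy.
rewrite !sub_affine2 !sqr_norm_affine2.
have -> : y - p - (y - q) = q - p by rewrite opprB addrC addrA subrK.
have -> : s - p - (s - q) = q - p by rewrite opprB addrC addrA subrK.
by rewrite lerD2r lerD// ler_wpM2l// subr_ge0.
Qed.

Lemma closed_closer (y s : H) : closed [set v : H | `|v - y| <= `|v - s|].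
Proof.
have -> : [set v : H | `|v - y| <= `|v - s|] =
    (fun v => `|v - y| - `|v - s|) @^-1` [set r | r <= 0].
  by apply/seteqP; split => v /=; rewrite subr_le0.
apply: preimage_closed; last exact: closed_le.
by move=> v _; apply: cvgB; apply: cvg_norm; apply: cvgB => //; exact: cvg_cst.
Qed.

(** * Resolvent points compared with solutions *)

Lemma sqr_dist_resolvent (p z s : H) : 0 <= dot (p - z) (z - s) ->
  `|p - z| ^+ 2 + `|z - s| ^+ 2 <= `|p - s| ^+ 2.
Proof.
by move=> ?; have := sqr_normD (p - z) (z - s); rewrite addrA subrK; lra.
Qed.

Context (C : set H).

(** Since [p] solves the problem, [f p z] is nonnegative, so monotonicity makes [f z p] nonpositive.
    The conclusion is the hypothesis of [sqr_dist_resolvent]. *)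
Lemma dot_equilibrium_ge0 (f : H -> H -> R) (p z s : H) (c : R) :
  equilibrium_bifunction C f -> EP C f p -> C z -> 0 < c ->
  0 <= f z p + c * dot (p - z) (z - s) -> 0 <= dot (p - z) (z - s).
Proof.
move=> [_ fmono _ _ _] [Cp fp] Cz c0 fz; rewrite -(pmulr_rge0 _ c0).
by have := fp _ Cz; have := fmono _ _ Cp Cz; lra.
Qed.

(** Same argument, with [dot (y - x) (A x)] in the role of the bifunction. *)
Lemma dot_VI_ge0 (A : H -> H) (p z s : H) (c : R) :
  monotone_mapping C dot A -> VI C dot A p -> C z -> 0 < c ->
  0 <= dot (p - z) (A z) + c * dot (p - z) (z - s) -> 0 <= dot (p - z) (z - s).
Proof.
move=> Amono [Cp Ap] Cz c0 Az; rewrite -(pmulr_rge0 _ c0).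
have := Ap _ Cz; have := Amono _ _ Cp Cz.
have -> : A p - A z = A p + (-1) *: A z by rewrite scaleN1r.
have -> : z - p = (-1) *: (p - z) by rewrite scaleN1r opprB.
by rewrite (dotC _ (_ + _)) dotDl !dotZl !(dotC (A _)); lra.
Qed.

(** * Limits of resolvent points *)

Context (C_convex : convex_set C).
Context {I : Type} (F : set_system I) (FF : ProperFilter F).
Context (z s : I -> H) (c : I -> R) (M : R) (l : H).
Context (zC : \forall n \near F, C (z n)) (c_bnd : forall n, 0 <= c n <= M).
Context (zl : z @ F --> l) (sl : s @ F --> l) (Cl : C l).

(** A bounded factor times one tending to 0. The filter [F] is arbitrary so that it can later be
    [\oo] restricted to an infinite set of indices. *)
Lemma cvg_resolvent_term (v : H) :
  c n * dot (v - z n) (z n - s n) @[n --> F] --> 0.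
Proof.
have dot0 : dot (v - z n) (z n - s n) @[n --> F] --> 0.
  have -> : 0 = dot (v - l) (l - l) by rewrite subrr linear0r.
  by apply: cvg_dot; apply: cvgB => //; exact: cvg_cst.
apply/norm_cvg0P; apply: (@squeeze_cvgr _ _ _ _ (cst 0)
  (fun n => M * `|dot (v - z n) (z n - s n)|)).
- apply: nearW => n; rewrite normr_ge0 normrM ler_wpM2r//.
  by have /andP[c0 cM] := c_bnd n; rewrite ger0_norm.
- exact: cvg_cst.
- rewrite -(mulr0 M); apply: cvgMl_tmp; rewrite -(normr0 R).
  exact: cvg_norm.
Qed.

(* Minty's argument: monotonicity turns the inequality for [f (z n) v] into one
   for [f v (z n)], where lower semicontinuity applies. *)
Lemma EP_limit (f : H -> H -> R) : equilibrium_bifunction C f ->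
  (\forall n \near F, forall v, C v ->
     0 <= f (z n) v + c n * dot (v - z n) (z n - s n)) ->
  EP C f l.
Proof.
move=> [fdiag fmono fhemi fconv flsc] fz.
have fl v : C v -> f v l <= 0.
  move=> Cv; rewrite leNgt; apply/negP => fvl.
  (* Half of [f v l] separates the two terms: near [l], [f v (z n)] exceeds it, while the resolvent
     term falls below it. *)
  have fvl2 : ((f v l / 2)%:E < (f v l)%:E)%E by rewrite lte_fin; lra.
  have [V lV fV] := flsc v Cv l _ fvl2.
  have {}lV : within C (nbhs l) V by rewrite nbhs_subspace_in.
  have zV : \forall n \near F, C (z n) -> V (z n) by exact: zl lV.
  have small : \forall n \near F, c n * dot (v - z n) (z n - s n) < f v l / 2.
    by apply: cvgr_lt (cvg_resolvent_term v) _ _; lra.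
  near F => n.
  have Czn : C (z n) by near: n.
  have Vzn : V (z n) by move: Czn; near: n.
  have := fV _ Vzn; rewrite lte_fin => f1.
  have f2 : c n * dot (v - z n) (z n - s n) < f v l / 2 by near: n.
  have /(_ v Cv) f3 : forall v, C v ->
    0 <= f (z n) v + c n * dot (v - z n) (z n - s n) by near: n.
  by have := fmono _ _ Cv Czn; lra.
split=> // v Cv.
(* With [w] on the segment from [l] to [v], convexity gives
   [0 = f w w <= t * f w v + (1 - t) * f w l], whose last term is nonpositive by [fl]. *)
have ft (t : R) : 0 < t < 1 -> 0 <= f (t *: v + (1 - t) *: l) v.
  move=> /andP[t0 t1].
  have t01 : 0 <= t <= 1 by rewrite !ltW.
  set w := _ + _; have Cw : C w by exact: (convex_setP _).1.
  have := convex_function_le (fconv _ Cw) t01 Cv Cl; rewrite -/w fdiag// => w0.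
  have : 0 <= t * f w v.
    have : (1 - t) * f w l <= 0 by rewrite mulr_ge0_le0 ?fl//; lra.
    by lra.
  by rewrite pmulr_rge0.
rewrite -lee_fin; apply: le_trans (fhemi _ _ _ Cl Cv Cv).
(* Every set in the filter of the upper limit contains some [t] in []0, 1[], where [ft] applies, so
   each supremum is nonnegative. *)
rewrite limf_esupE; apply: le_ereal_inf_tmp => _ [V V0 <-].
near (0 : R)^'+ => t.
apply: (@le_trans _ _ (f (t *: v + (1 - t) *: l) v)%:E).
  rewrite lee_fin ft//; apply/andP; split; near: t.
    exact: nbhs_right_gt.
  exact: nbhs_right_lt.
by apply: ereal_sup_ubound; exists t => //; near: t.
Unshelve. all: by end_near. Qed.

(** Continuity of [A] on [C] lets the inequality itself pass to the limit. *)
Lemma VI_limit (A : H -> H) : {within C, continuous A} ->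
  (\forall n \near F, forall v, C v ->
     0 <= dot (v - z n) (A (z n)) + c n * dot (v - z n) (z n - s n)) ->
  VI C dot A l.
Proof.
move=> /subspace_continuousP/(_ _ Cl) Al Az; split=> // v Cv.
have Azl : A (z n) @[n --> F] --> A l.
  apply: cvg_comp Al => U lU.
  by apply: filterS2 zC (zl lU) => n Czn; apply.
have lim : dot (v - z n) (A (z n)) + c n * dot (v - z n) (z n - s n)
    @[n --> F] --> dot (v - l) (A l).
  rewrite -[X in _ --> X]addr0; apply: cvgD (cvg_resolvent_term v).
  by apply: cvg_dot => //; apply: cvgB => //; exact: cvg_cst.
apply: cvgr_to_ge lim _; near=> n.
suff : forall v, C v ->
  0 <= dot (v - z n) (A (z n)) + c n * dot (v - z n) (z n - s n) by exact.
by near: n.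
Unshelve. all: by end_near. Qed.

End Hilbert.

(** * Auxiliary facts on sequences and index filters *)

Lemma cvg_of_sqr_norm (R : realType) (V : normedModType R) (g : nat -> V) (k : R)
    (e : nat -> R) : 0 < k -> e n @[n --> \oo] --> 0 ->
  (forall n, k * `|g n| ^+ 2 <= e n) -> g n @[n --> \oo] --> 0.
Proof.
move=> k0 e0 ge; apply/cvgr0Pnorm_lt => eps eps0; near=> n.
rewrite -(@ltr_pXn2r _ 2) ?nnegrE ?(ltW eps0)// -(ltr_pM2l k0).
apply: le_lt_trans (ge n) _; near: n.
by apply: cvgr_lt e0 _ _; rewrite mulr_gt0// exprn_gt0.
Unshelve. all: by end_near. Qed.

(** An infinite set of indices meets every tail. This filter replaces extracting a subsequence. *)
Lemma within_infinite_proper (D : set nat) :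
  infinite_set D -> ProperFilter (within D \oo).
Proof.
move=> Dinf; split; last exact: within_filter.
move=> [N _ ND]; apply: Dinf; apply: (sub_finite_set _ (finite_II N)) => n Dn /=.
by rewrite ltnNge; apply/negP => Nn; exact: ND Nn Dn.
Qed.

Theorem corollary4p5 (R : realType) (H : completeNormedModType R)
  (dot : {dot H for (@idfun R)}) (hdot : induces_norm dot)
  (C : set H) (C_neq0 : C !=set0) (C_closed : closed C) (C_convex : convex_set C)
  (f : nat -> H -> H -> R) (hf : forall i, equilibrium_bifunction C (f i))
  (A : nat -> H -> H)
  (A_cont : forall j, {within C, continuous (A j)})
  (A_mono : forall j, monotone_mapping C dot (A j))
  (T : nat -> H -> H) (hT : forall n, nonexpansive_type C (T n))
  (Gamma : set (H -> H))
  (hGamma : forall S, Gamma S -> closed_mapping C S /\ nonexpansive_type C S)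
  (hfix : \bigcap_n fixpts C (T n) = common_fixpts C Gamma)
  (hfix_neq0 : common_fixpts C Gamma !=set0)
  (hNST : NST_condition C T Gamma)
  (B : set H)
  (B_def : B = common_fixpts C Gamma `&` (\bigcap_i EP C (f i))
                 `&` (\bigcap_j VI C dot (A j)))
  (B_neq0 : B !=set0) (B_closed : closed B) (B_convex : convex_set B)
  (mu nu : nat -> nat)
  (hmu : forall i, infinite_set [set n | mu n = i])
  (hnu : forall j, infinite_set [set n | nu n = j])
  (h : {fun C >-> C}) (rho : {nonneg R}) (rho_gt0 : 0 < rho%:num)
  (hcontr : contraction rho h)
  (ubar : H) (hubar : C ubar)
  (lambda sigma : nat -> R)
  (hlambda : forall n, 0 <= lambda n < 1)
  (hsigma : forall n, 0 <= sigma n < 1)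
  (hlambdasigma : forall n, lambda n + sigma n < 1)
  (lambda_cvg : lambda n @[n --> \oo] --> (0 : R))
  (sigma_cvg : sigma n @[n --> \oo] --> (0 : R))
  (alpha1 alpha2 alpha3 : R)
  (halpha1 : 0 < alpha1 < 1) (halpha2 : 0 < alpha2 < 1)
  (halpha3 : 0 < alpha3 < 1) (halpha : alpha1 + alpha2 + alpha3 = 1)
  (a : R) (a_gt0 : 0 < a) (r : nat -> R) (hr : forall n, a <= r n)
  (x s z u y : nat -> H) (Cn : nat -> set H)
  (x0_in : C (x 0%N)) (C0_def : Cn 0%N = C)
  (s_def : forall n, s n = lambda n *: h (x n) + sigma n *: ubar
                             + (1 - lambda n - sigma n) *: x n)
  (z_def : forall n,
    [set w | C w /\ forall v, C v ->
       0 <= f (mu n) w v + (r n)^-1 * dot (v - w) (w - s n)] = [set z n])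
  (u_def : forall n,
    [set w | C w /\ forall v, C v ->
       0 <= dot (v - w) (A (nu n) w) + (r n)^-1 * dot (v - w) (w - s n)]
      = [set u n])
  (y_def : forall n,
    y n = alpha1 *: s n + alpha2 *: z n + alpha3 *: T n (u n))
  (CS_def : forall n,
    Cn n.+1 = [set v | Cn n v /\ `|v - y n| <= `|v - s n|])
  (xS_def : forall n, x n.+1 = metric_proj (Cn n.+1) (x 0%N)) :
  x n @[n --> \oo] --> metric_proj B (x 0%N).
Proof.
have [a1 a2 a3] : [/\ 0 < alpha1, 0 < alpha2 & 0 < alpha3].
  by case/andP: halpha1; case/andP: halpha2; case/andP: halpha3.
have r_gt0 n : 0 < r n by exact: lt_le_trans (hr n).
have rV_bnd n : 0 <= (r n)^-1 <= a^-1.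
  by rewrite invr_ge0 (ltW (r_gt0 n)) lef_pV2 ?posrE//= hr.
have zP n : C (z n) /\ forall v, C v ->
    0 <= f (mu n) (z n) v + (r n)^-1 * dot (v - z n) (z n - s n).
  by have : [set z n] (z n) by []; rewrite -z_def.
have uP n : C (u n) /\ forall v, C v ->
    0 <= dot (v - u n) (A (nu n) (u n)) + (r n)^-1 * dot (v - u n) (u n - s n).
  by have : [set u n] (u n) by []; rewrite -u_def.
have BP p : B p -> [/\ C p, forall n, T n p = p, forall i, EP C (f i) p &
    forall j, VI C dot (A j) p].
  rewrite B_def -hfix => -[[pT pE] pV]; split=> [||i|j].
  - by have [] := pT 0%N I.
  - by move=> n; have [] := pT n I.
  - exact: pE.
  - exact: pV.

(* The basic inequality at a common solution *)
have key p n : B p -> alpha2 * `|z n - s n| ^+ 2 + alpha3 * `|u n - s n| ^+ 2 <=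
    `|p - s n| ^+ 2 - `|p - y n| ^+ 2.
  move=> /BP[Cp pT pE pV].
  have [Czn zn] := zP n; have [Cun un] := uP n.
  have rV_gt0 : 0 < (r n)^-1 by rewrite invr_gt0.
  have pzs := sqr_dist_resolvent hdot
    (dot_equilibrium_ge0 (hf _) (pE _) Czn rV_gt0 (zn _ Cp)).
  have pus := sqr_dist_resolvent hdot
    (dot_VI_ge0 (A_mono _) (pV _) Cun rV_gt0 (un _ Cp)).
  have pTu : `|p - T n (u n)| ^+ 2 <= `|p - u n| ^+ 2.
    by rewrite ler_pXn2r ?nnegrE//; apply: (hT n).2 => //; split.
  have -> : p - y n =
      alpha1 *: (p - s n) + alpha2 *: (p - z n) + alpha3 *: (p - T n (u n)).
    rewrite y_def !scalerBr (addrACA (alpha1 *: p)) (addrACA (alpha1 *: p + _)).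
    rewrite -!opprD -!scalerDl.
    by rewrite halpha scale1r.
  have pz := ler_wpM2l (ltW a2) pzs.
  have {}pTu : `|p - T n (u n)| ^+ 2 + `|u n - s n| ^+ 2 <= `|p - s n| ^+ 2.
    by apply: le_trans pus; rewrite lerD2r.
  have pu := ler_wpM2l (ltW a3) pTu.
  rewrite (sqr_norm_affine3 hdot)//.
  have dist_ge0 b c (v w : H) : 0 < b -> 0 < c -> 0 <= b * c * `|v - w| ^+ 2.
    by move=> b0 c0; rewrite !mulr_ge0// ?exprn_ge0// ltW.
  have := dist_ge0 _ _ (p - s n) (p - z n) a1 a2.
  have := dist_ge0 _ _ (p - s n) (p - T n (u n)) a1 a3.
  have := dist_ge0 _ _ (p - z n) (p - T n (u n)) a2 a3.
  (* Eliminating [alpha1] here leaves an inequality that is linear in the remaining products, as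
     [lra] requires. *)
  have -> : alpha1 * `|p - s n| ^+ 2 =
      `|p - s n| ^+ 2 - alpha2 * `|p - s n| ^+ 2 - alpha3 * `|p - s n| ^+ 2.
    by rewrite -[X in X - _ - _]mul1r -!mulrBl; congr (_ * _); lra.
  by move: pz pu; lra.

(* The sets [Cn n] and the projections onto them *)
have CnC n : Cn n `<=` C.
  by elim: n => [|n IHn]; rewrite ?C0_def// CS_def => v [/IHn].
have Cn_dec n m : (n <= m)%N -> Cn m `<=` Cn n.
  elim: m => [|m IHm]; first by rewrite leqn0 => /eqP ->.
  rewrite leq_eqVlt => /predU1P[-> //|/IHm Cmn].
  by rewrite CS_def => v [/Cmn].
have CSE n : Cn n.+1 = Cn n `&` [set v | `|v - y n| <= `|v - s n|].
  by rewrite CS_def.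
have Cn_closed n : closed (Cn n).
  elim: n => [|n IHn]; first by rewrite C0_def.
  by rewrite CSE; apply: closedI => //; exact: closed_closer.
have Cn_convex n : convex_set (Cn n).
  elim: n => [|n IHn]; first by rewrite C0_def.
  rewrite CSE => v w t; rewrite !inE => -[v1 v2] [w1 w2]; split.
    by have := IHn v w t; rewrite !inE; exact.
  by have := convex_closer hdot t (mem_set v2) (mem_set w2); rewrite inE.
have BCn n : B `<=` Cn n.
  elim: n => [|n IHn] p Bp; first by rewrite C0_def; case: (BP _ Bp).
  rewrite CSE; split; first exact: IHn.
  rewrite /= -(@ler_pXn2r _ 2) ?nnegrE// -subr_ge0.
  by apply: le_trans (key _ _ Bp); rewrite addr_ge0// mulr_ge0// ?ltW// exprn_ge0.
have xP n : Cn n (x n) /\ forall q, Cn n q -> `|x 0%N - x n| <= `|x 0%N - q|.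
  (* The starting point is not given as a projection, but it is at distance 0 from itself. *)
  case: n => [|n]; first by rewrite C0_def subrr normr0.
  have CSn0 : Cn n.+1 !=set0 by case: B_neq0 => p Bp; exists p; exact: BCn.
  by rewrite xS_def; exact: (metric_projP hdot CSn0 (Cn_closed _) (@Cn_convex _)).
have [p0 Bp0] := B_neq0.

(* Strong convergence of the iterates *)
have [xs xxs] : exists l : H, x n @[n --> \oo] --> l.
  (* By [sqr_dist_proj], the squared distance from [x n] to [x m] is at most [2 * (D m - D n)];
     replacing [D m] by the supremum gives a bound in [n] alone. *)
  pose D n := `|x 0%N - x n| ^+ 2.
  have Dmono : {homo D : n m / (n <= m)%N >-> n <= m}.
    move=> n m nm; rewrite ler_pXn2r ?nnegrE//.
    by apply: (xP n).2; apply: Cn_dec nm _ _; case: (xP m).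
  have Dbnd : has_ubound (range D).
    exists (`|x 0%N - p0| ^+ 2) => _ [n _ <-].
    by rewrite ler_pXn2r ?nnegrE//; apply: (xP n).2; exact: BCn.
  have Dcvg := nondecreasing_cvgn Dmono Dbnd.
  have e0 : 2 * (sup (range D) - D n) @[n --> \oo] --> 0.
    rewrite -[X in _ --> X](mulr0 2) -(subrr (sup (range D))).
    by apply: cvgMl_tmp; apply: cvgB => //; exact: cvg_cst.
  apply/cvg_ex; apply: (cvg_of_sqr_dist e0) => m n nm.
  have xm : Cn n (x m) by apply: Cn_dec nm _ _; case: (xP m).
  apply: le_trans (sqr_dist_proj hdot (@Cn_convex n) (xP n).1 (xP n).2 xm) _.
  by rewrite ler_pM2l// lerD2r; apply: ub_le_sup => //; exists m.
have Cx n : C (x n) by apply: (CnC n); case: (xP n).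
have Cxs : C xs by apply: (closed_cvg _ C_closed _ _ xxs); exact: nearW.
have hxs : h (x n) @[n --> \oo] --> h xs.
  apply/cvgrPdist_lt => eps eps0; have [rho_lt1 hlip] := hcontr.
  near=> n; apply: (@le_lt_trans _ _ `|xs - x n|); last first.
    by near: n; exact: cvgr_dist_lt.
  have /le_trans -> // := hlip (xs, x n) (conj Cxs (Cx n)).
  by rewrite /= ler_piMl// ltW.

(* The auxiliary sequences share the limit *)
have sxs : s n @[n --> \oo] --> xs.
  have -> : xs = 0 *: h xs + 0 *: ubar + (1 - 0 - 0) *: xs.
    by rewrite !scale0r !subr0 scale1r !add0r.
  under eq_fun do rewrite s_def.
  apply: cvgD; first by apply: cvgD; apply: cvgZ => //; exact: cvg_cst.
  by apply: cvgZ => //; apply: cvgB => //; apply: cvgB => //; exact: cvg_cst.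
have xSxs : x n.+1 @[n --> \oo] --> xs by rewrite -cvg_shiftS in xxs.
have yxs : y n @[n --> \oo] --> xs.
  (* Membership of [x n.+1] in [Cn n.+1] bounds its distance to [y n] by its distance to [s n]. *)
  have xy0 : x n.+1 - y n @[n --> \oo] --> 0.
    apply/norm_cvg0P; apply: (@squeeze_cvgr _ _ _ _ (cst 0) (fun n => `|x n.+1 - s n|)).
    - by apply: nearW => n; rewrite normr_ge0; have [] := xP n.+1; rewrite CSE => -[].
    - exact: cvg_cst.
    - by rewrite -(normr0 H) -(subrr xs); apply: cvg_norm; exact: cvgB.
  rewrite -(subr0 xs); under eq_fun => n do rewrite -(subKr (x n.+1) (y n)).
  exact: cvgB.
have e0 : `|p0 - s n| ^+ 2 - `|p0 - y n| ^+ 2 @[n --> \oo] --> 0.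
  rewrite -(subrr (`|p0 - xs| ^+ 2)) expr2; under eq_fun do rewrite !expr2.
  by apply: cvgB; apply: cvgM; apply: cvg_norm; apply: cvgB => //; exact: cvg_cst.
have zxs : z n @[n --> \oo] --> xs.
  have zs0 : z n - s n @[n --> \oo] --> 0.
    apply: (cvg_of_sqr_norm a2 e0) => n; apply: le_trans (key _ n Bp0).
    by rewrite lerDl mulr_ge0 ?exprn_ge0// ltW.
  rewrite -(add0r xs); under eq_fun => n do rewrite -(subrK (s n) (z n)).
  exact: cvgD.
have uxs : u n @[n --> \oo] --> xs.
  have us0 : u n - s n @[n --> \oo] --> 0.
    apply: (cvg_of_sqr_norm a3 e0) => n; apply: le_trans (key _ n Bp0).
    by rewrite lerDr mulr_ge0 ?exprn_ge0// ltW.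
  rewrite -(add0r xs); under eq_fun => n do rewrite -(subrK (s n) (u n)).
  exact: cvgD.
have Tuxs : T n (u n) @[n --> \oo] --> xs.
  (* The definition of [y n] is solved for [T n (u n)], as [alpha3] is positive. *)
  have TE n : T n (u n) = alpha3^-1 *: (y n - (alpha1 *: s n + alpha2 *: z n)).
    by rewrite y_def addrC addKr scalerK// gt_eqF.
  have -> : xs = alpha3^-1 *: (xs - (alpha1 *: xs + alpha2 *: xs)).
    rewrite -scalerDl -[X in X - _]scale1r -scalerBl -halpha addrC addKr.
    by rewrite scalerK// gt_eqF.
  under eq_fun do rewrite TE.
  apply: cvgZ; first exact: cvg_cst.
  by apply: cvgB => //; apply: cvgD; apply: cvgZ => //; exact: cvg_cst.
have uTu0 : `|u n - T n (u n)| @[n --> \oo] --> (0 : R).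
  by rewrite -(normr0 H) -(subrr xs); apply: cvg_norm; exact: cvgB.
have u_bnd : bounded_fun u by apply: cvg_seq_bounded; apply/cvg_ex; exists xs.

(* The limit is a common solution *)
have Bxs : B xs.
  rewrite B_def; split; first split.
  - move=> S GS; split=> //; have [Sclosed _] := hGamma S GS.
    apply: (Sclosed u) => //; first by move=> n; case: (uP n).
    (* The NST condition moves the vanishing residual from [T n] to [S], so [S (u n)] also tends to
       [xs] and closedness of [S] applies. *)
    have /norm_cvg0P uS0 := hNST _ (fun n => (uP n).1) u_bnd uTu0 _ GS.
    rewrite -(subr0 xs); under eq_fun => n do rewrite -(subKr (u n) (S (u n))).
    exact: cvgB.
  (* Along the indices with [mu n = i], the point [z n] is a resolvent point of the single
     bifunction [f i]. *)
  - move=> i _; have FF := within_infinite_proper (hmu i).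
    apply: (EP_limit hdot C_convex FF (z := z) (s := s) _ rV_bnd _ _ Cxs (hf i)).
    + by apply: nearW => n; case: (zP n).
    + exact: cvg_within_filter.
    + exact: cvg_within_filter.
    + by rewrite near_withinE; apply: nearW => n <-; case: (zP n).
  - move=> j _; have FF := within_infinite_proper (hnu j).
    apply: (VI_limit hdot FF (z := u) (s := s) _ rV_bnd _ _ Cxs) => //.
    + by apply: nearW => n; case: (uP n).
    + exact: cvg_within_filter.
    + exact: cvg_within_filter.
    + by rewrite near_withinE; apply: nearW => n <-; case: (uP n).

(* The limit is the nearest point of [B] *)
suff -> : metric_proj B (x 0%N) = xs by [].
apply: (metric_proj_unique hdot B_neq0 B_closed B_convex Bxs) => q Bq.
have x0xs : `|x 0%N - x n| @[n --> \oo] --> `|x 0%N - xs|.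
  by apply: cvg_norm; apply: cvgB => //; exact: cvg_cst.
apply: (cvgr_to_le x0xs).
by apply: nearW => n; apply: (xP n).2; exact: BCn.
Unshelve. all: by end_near. Qed.
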